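(* Let $b\in[n]$ and, for every $i\in[n]$, let $S^i$ be a $(b-1)$-nice sampling over $[n]\setminus\{i\}$. Then the expected smoothness constant $\mathcal{L}=\mathcal{L}(b)$ of $b$-nice sampling satisfies $$\mathcal{L}\le\mathcal{L}_{\mathrm{practical}}(b)+U\max_{i\in[n]}\mathbb{E}\big[\lambda_{\max}(N_i)\big],$$ where $$N_i:=\frac1b\sum_{j\in S^i}a_ja_j^\top-\frac1b\,\frac{b-1}{n-1}\sum_{j\in[n]\setminus\{i\}}a_ja_j^\top .$$
   Context: Let $n\ge 2$ and $d\ge 1$ be integers, $[n]=\{1,\dots,n\}$, let $a_1,\dots,a_n\in\mathbb{R}^d$, and let $U\ge 0$. (These come from a generalized linear model $f(w)=\frac1n\sum_{i=1}^n\phi_i(a_i^\top w)+\frac{\lambda}{2}\|w\|_2^2$ with convex $\phi_i$ satisfying $\phi_i''\le U$.) For nonempty $B\subseteq[n]$ define $$L_B:=\frac{U}{|B|}\lambda_{\max}\Big(\sum_{j\in B}a_ja_j^\top\Big),$$ where $\lambda_{\max}$ is the largest eigenvalue. Set $L_i:=L_{\{i\}}=U\|a_i\|_2^2$, $L_{\max}:=\max_{i\in[n]}L_i$, and $L:=L_{[n]}$. An $m$-nice sampling over a finite set $E$ is a random subset of $E$ uniformly distributed over all subsets of $E$ of size $m$ (the empty set if $m=0$). The expected smoothness constant of $b$-nice sampling over $[n]$ is $$\mathcal{L}:=\frac{1}{\binom{n-1}{b-1}}\max_{i\in[n]}\ \sum_{B\subseteq[n]:\,|B|=b,\ i\in B}L_B.$$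 The practical estimate is $$\mathcal{L}_{\mathrm{practical}}(b):=\frac nb\,\frac{b-1}{n-1}\,L+\frac1b\,\frac{n-b}{n-1}\,L_{\max}.$$ *)

(* Defs.v *)
From mathcomp Require Export all_boot all_order all_algebra.
From mathcomp Require Export all_classical all_reals all_analysis.

Set Implicit Arguments.
Unset Strict Implicit.
Unset Printing Implicit Defensive.

Import Order.TTheory GRing.Theory Num.Theory.
Local Open Scope classical_set_scope.
Local Open Scope ring_scope.

(* A matrix has finitely many eigenvalues, and a real symmetric matrix of
   positive size has at least one, so for such matrices the supremum below is
   attained and is the largest eigenvalue. *)
Definition lambda_max (R : realType) (d : nat) (A : 'M[R]_d) : R :=
  sup [set x | eigenvalue A x].

(* The maximum of a finite nonempty family, for 0 < n. Using [sup] avoids a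
   default value that could interfere with the maximum. *)
Definition fam_max (R : realType) (n : nat) (f : 'I_n -> R) : R :=
  sup (range f).

Definition outer (R : realType) (d : nat) (v : 'cV[R]_d) : 'M[R]_d :=
  v *m v^T.

Section ExpectedSmoothness.
Variables (R : realType) (n d : nat) (a : 'I_n -> 'cV[R]_d) (U : R).

(* Only meaningful for nonempty B. *)
Definition smooth (B : {set 'I_n}) : R :=
  U / #|B|%:R * lambda_max (\sum_(j in B) outer (a j)).

Definition smooth_max : R := fam_max (fun i => smooth [set i]%SET).

Definition smooth_full : R := smooth [set: 'I_n]%SET.

Definition expected_smoothness (b : nat) : R :=
  ('C(n.-1, b.-1)%:R)^-1 *
  fam_max (fun i : 'I_n =>
    \sum_(B : {set 'I_n} | (#|B| == b) && (i \in B)) smooth B).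

Definition practical_smoothness (b : nat) : R :=
  n%:R / b%:R * ((b%:R - 1) / (n%:R - 1)) * smooth_full
  + b%:R^-1 * ((n%:R - b%:R) / (n%:R - 1)) * smooth_max.

(* The matrix N_i when the sample S^i takes the value C. *)
Definition deviation_mx (b : nat) (i : 'I_n) (C : {set 'I_n}) : 'M[R]_d :=
  b%:R^-1 *: (\sum_(j in C) outer (a j))
  - (b%:R^-1 * ((b%:R - 1) / (n%:R - 1))) *:
      (\sum_(j in [set~ i]%SET) outer (a j)).

End ExpectedSmoothness.

(* S is a random subset with the uniform law on the m-element subsets of E;
   measurability is stated on the fibers of S, which have finitely many values. *)
Definition nice_sampling (disp : measure_display) (Omega : measurableType disp)
    (R : realType) (P : probability Omega R) (T : finType)
    (m : nat) (E : {set T}) (S : Omega -> {set T}) : Prop :=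
  forall C : {set T},
    measurable (S @^-1` [set C]) /\
    P (S @^-1` [set C]) =
      (if (C \subset E) && (#|C| == m) then ('C(#|E|, m)%:R)^-1 else 0)%:E.

(* Main.v *)
(* The largest eigenvalue of a real symmetric matrix is the maximum of its
   Rayleigh quotient, hence it is subadditive and positively homogeneous. With
   A the sum of all a_j a_j^T, for |C| = b - 1 and i not in C,
     (1/b) sum_(j in C + i) a_j a_j^T
       = N_i(C) + (b-1)/(b(n-1)) A + (n-b)/(b(n-1)) a_i a_i^T,
   so L_(C + i) <= L_practical(b) + U lambda_max(N_i(C)). Averaging over C, that
   is over the law of S^i, for the index i attaining the maximum in the
   expected smoothness constant gives the claim. *)
Require Import Defs.
From mathcomp Require Import ring.

Set Implicit Arguments.
Unset Strict Implicit.
Unset Printing Implicit Defensive.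

Import Order.TTheory GRing.Theory Num.Theory.
Import numFieldNormedType.Exports.
Local Open Scope classical_set_scope.
Local Open Scope ring_scope.

(** Row vectors fit [eigenvalue], which refers to left eigenvectors. Taking [A] to be [1%:M] gives
    the Euclidean inner product, so squared norms are written [bilin 1%:M u u]. *)
Definition bilin (R : realType) (d : nat) (A : 'M[R]_d) (u v : 'rV[R]_d) : R :=
  (u *m A *m v^T) 0 0.

(** * Rayleigh quotients and the largest eigenvalue *)

Section Rayleigh.
Variables (R : realType) (d : nat).
Implicit Types (A B : 'M[R]_d) (u v w : 'rV[R]_d).

Lemma bilinDm A B u v : bilin (A + B) u v = bilin A u v + bilin B u v.
Proof. by rewrite /bilin mulmxDr mulmxDl mxE. Qed.

Lemma bilinZm k A u v : bilin (k *: A) u v = k * bilin A u v.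
Proof. by rewrite /bilin -scalemxAr -scalemxAl mxE. Qed.

Lemma bilinDl A u v w : bilin A (u + v) w = bilin A u w + bilin A v w.
Proof. by rewrite /bilin !mulmxDl mxE. Qed.

Lemma bilinZl A k u w : bilin A (k *: u) w = k * bilin A u w.
Proof. by rewrite /bilin -!scalemxAl mxE. Qed.

Lemma bilinC A u v : A^T = A -> bilin A u v = bilin A v u.
Proof.
move=> sA; rewrite /bilin; transitivity ((u *m A *m v^T)^T 0 0).
  by rewrite [RHS]mxE.
by rewrite !trmx_mul trmxK sA mulmxA.
Qed.

Lemma bilin1E u : bilin 1%:M u u = \sum_i u 0 i ^+ 2.
Proof. by rewrite /bilin mulmx1 mxE; apply: eq_bigr => i _; rewrite mxE. Qed.

Lemma bilin1_ge0 u : 0 <= bilin 1%:M u u.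
Proof. by rewrite bilin1E sumr_ge0// => i _; rewrite sqr_ge0. Qed.

Lemma bilin1_eq0 u : (bilin 1%:M u u == 0) = (u == 0).
Proof.
apply/idP/eqP => [|->]; last by rewrite /bilin !mul0mx mxE.
rewrite bilin1E psumr_eq0 => [|i _]; last by rewrite sqr_ge0.
move=> /allP u0; apply/rowP => i; rewrite mxE.
by apply/eqP; rewrite -sqrf_eq0; apply: u0; rewrite mem_index_enum.
Qed.

Lemma bilin1_gt0 u : (0 < bilin 1%:M u u) = (u != 0).
Proof. by rewrite lt_neqAle eq_sym bilin1_eq0 bilin1_ge0 andbT. Qed.

Lemma continuous_bilin_diag A : continuous (fun u => bilin A u u).
Proof.
have E v : bilin A v v = \sum_j (\sum_k v 0 k * A k j) * v 0 j.
  by rewrite /bilin mxE; apply: eq_bigr => j _; rewrite !mxE.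
rewrite (funext E); apply: (@continuous_big R _ +%R 0 predT) => [|j _].
  exact: add_continuous.
move=> u; apply: continuousM; last exact: coord_continuous.
apply: (@continuous_big R _ +%R 0 predT) => [|k _]; first exact: add_continuous.
move=> v; apply: continuousM; last exact: cst_continuous.
exact: coord_continuous.
Qed.

(** The sphere is closed, as a level set of a continuous form, and lies in the cube [-1, 1]^d
    because each squared coordinate is at most the whole sum. *)
Lemma compact_sphere : compact [set u : 'rV[R]_d | bilin 1%:M u u = 1].
Proof.
have box : compact [set u : 'rV[R]_d | forall i, u ord0 i \in `[-1, 1]].
  apply: (@rV_compact R d (fun=> `[-1, 1]%classic)).
  by move=> i; exact: segment_compact.
apply: subclosed_compact box _.
- rewrite (_ : mkset _ = (fun u => bilin 1%:M u u) @^-1` [set 1])//.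
  by move/continuous_closedP: (@continuous_bilin_diag 1%:M); apply; exact: closed_eq.
- move=> u /=; rewrite bilin1E => u1 i.
  rewrite in_itv /= -ler_norml -(@ler_pXn2r _ 2)// ?nnegrE// real_normK ?num_real//.
  rewrite expr1n -u1 (bigD1 i)//= lerDl sumr_ge0// => j _; exact: sqr_ge0.
Qed.

(** The form is minimal at [c], so its derivative there in the direction [c *m B] vanishes; that
    derivative is twice the squared norm of [c *m B]. *)
Lemma bilin_ge0_ker B c : B^T = B -> (forall u, 0 <= bilin B u u) ->
  bilin B c c = 0 -> c *m B = 0.
Proof.
move=> sB B0 Bc; pose w := c *m B; apply/eqP; rewrite -bilin1_eq0.
have -> : bilin 1%:M (c *m B) (c *m B) = bilin B c w by rewrite /bilin mulmx1.
set p := bilin B c w; set q := bilin B w w.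
have q0 : 0 <= q := B0 w.
(* The minimizing t would be - p / q, but q may be 0; the denominator [q + 1] avoids a case
   split. *)
have q1 : q + 1 != 0 by rewrite gt_eqF// ltr_wpDl.
(* The quadratic t |-> bilin B (c + t w) (c + t w) = 2 p t + q t^2 is
   nonnegative; this t makes it negative unless p = 0. *)
pose t := - p / (q + 1).
have := B0 (c + t *: w).
rewrite bilinDl bilinZl [bilin _ c _]bilinC// [bilin _ w _]bilinC//.
rewrite !bilinDl !bilinZl Bc -/q [bilin _ w c]bilinC// -/p.
have -> : 0 + t * p + t * (p + t * q) = - (p ^+ 2 * (q + 2) / (q + 1) ^+ 2).
  by rewrite /t; field.
rewrite oppr_ge0 => h; rewrite -sqrf_eq0 eq_le sqr_ge0 andbT.
move: h; rewrite pmulr_lle0 ?invr_gt0 ?exprn_gt0 ?ltr_wpDl//.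
by rewrite pmulr_lle0// ltr_wpDl.
Qed.

(** Let [c] maximize the form of [A] on the unit sphere, with value [M]. Then [M%:M - A] has a
    nonnegative form that vanishes at [c], so [c] lies in its kernel and is an eigenvector for
    [M]. *)
Lemma exists_max_eigen A : (0 < d)%N -> A^T = A ->
  exists2 M, eigenvalue A M & forall u, bilin A u u <= M * bilin 1%:M u u.
Proof.
move=> d0 sA.
have S0 : [set u : 'rV[R]_d | bilin 1%:M u u = 1] !=set0.
  exists (delta_mx 0 (Ordinal d0)).
  rewrite /= bilin1E (bigD1 (Ordinal d0))//= mxE !eqxx expr1n big1 ?addr0// => i.
  by rewrite mxE => /negbTE ->; rewrite andbF expr0n.
have [|c] := EVT_max_rV (f := fun u => bilin A u u) S0 compact_sphere.
  by apply: continuous_subspaceT; exact: continuous_bilin_diag.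
rewrite inE /= => c1 cmax; set M := bilin A c c in cmax.
have MP u : bilin A u u <= M * bilin 1%:M u u.
  have [->|u0] := eqVneq u 0.
    by rewrite /bilin !mul0mx mxE mulr0.
  have uu0 : 0 < bilin 1%:M u u by rewrite bilin1_gt0.
  pose s := (Num.sqrt (bilin 1%:M u u))^-1.
  have s2 : s * s = (bilin 1%:M u u)^-1.
    by rewrite -expr2 exprVn sqr_sqrtr// ltW.
  have bilin_s B : B^T = B ->
      bilin B (s *: u) (s *: u) = (bilin 1%:M u u)^-1 * bilin B u u.
    by move=> sB; rewrite bilinZl bilinC// bilinZl mulrA s2.
  have := cmax (s *: u); rewrite inE /= !bilin_s ?trmx1// mulVf ?gt_eqF// => /(_ erefl).
  by rewrite mulrC ler_pdivrMr.
exists M => //; apply/eigenvalueP; exists c; last first.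
  by rewrite -bilin1_eq0 c1 oner_eq0.
have sB : (M%:M - A)^T = M%:M - A by rewrite linearB /= tr_scalar_mx sA.
have E u : bilin (M%:M - A) u u = M * bilin 1%:M u u - bilin A u u.
  by rewrite -[M%:M]scalemx1 bilinDm bilinZm -[- A]scaleN1r bilinZm mulN1r.
have h1 u : 0 <= bilin (M%:M - A) u u by rewrite E subr_ge0.
have h2 : bilin (M%:M - A) c c = 0 by rewrite E c1 mulr1 subrr.
have /eqP := bilin_ge0_ker sB h1 h2.
by rewrite mulmxBr mul_mx_scalar subr_eq0 eq_sym => /eqP.
Qed.

(** An eigenvalue is the Rayleigh quotient of its eigenvector, hence at most the [M] of
    [exists_max_eigen]; so the supremum equals [M]. *)
Lemma lambda_maxP A : (0 < d)%N -> A^T = A ->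
  eigenvalue A (lambda_max A) /\
  forall u, bilin A u u <= lambda_max A * bilin 1%:M u u.
Proof.
move=> d0 sA; have [M eM MP] := exists_max_eigen d0 sA.
suff -> : lambda_max A = M by [].
have ubM : ubound [set x | eigenvalue A x] M.
  move=> x /eigenvalueP[u ux u0].
  have uu0 : 0 < bilin 1%:M u u by rewrite bilin1_gt0.
  rewrite -(ler_pM2r uu0); apply: le_trans (MP u).
  by rewrite -bilinZl /bilin mulmx1 ux.
apply/le_anti; rewrite ge_sup//=; last by exists M.
by rewrite ub_le_sup//; exists M.
Qed.

Lemma lambda_max_le A x : (0 < d)%N -> A^T = A ->
  (forall u, bilin A u u <= x * bilin 1%:M u u) -> lambda_max A <= x.
Proof.
move=> d0 sA xP; have [/eigenvalueP[u ux u0] _] := lambda_maxP d0 sA.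
have uu0 : 0 < bilin 1%:M u u by rewrite bilin1_gt0.
rewrite -(ler_pM2r uu0); apply: le_trans (xP u).
by rewrite -bilinZl /bilin mulmx1 ux.
Qed.

Lemma lambda_maxD_le A B : (0 < d)%N -> A^T = A -> B^T = B ->
  lambda_max (A + B) <= lambda_max A + lambda_max B.
Proof.
move=> d0 sA sB; apply: lambda_max_le => //; first by rewrite linearD /= sA sB.
move=> u; rewrite bilinDm mulrDl lerD//.
  exact: (lambda_maxP d0 sA).2.
exact: (lambda_maxP d0 sB).2.
Qed.

Lemma lambda_maxZ_le k A : (0 < d)%N -> A^T = A -> 0 <= k ->
  lambda_max (k *: A) <= k * lambda_max A.
Proof.
move=> d0 sA k0; apply: lambda_max_le => //; first by rewrite linearZ /= sA.
by move=> u; rewrite bilinZm -mulrA ler_wpM2l//; exact: (lambda_maxP d0 sA).2.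
Qed.

End Rayleigh.

(** * Outer products, finite maxima and nice samplings *)

Lemma tr_outer (R : realType) (d : nat) (v : 'cV[R]_d) : (outer v)^T = outer v.
Proof. by rewrite /outer trmx_mul trmxK. Qed.

Lemma tr_sum_outer (R : realType) (n d : nat) (a : 'I_n -> 'cV[R]_d) (B : {set 'I_n}) :
  (\sum_(j in B) outer (a j))^T = \sum_(j in B) outer (a j).
Proof. by rewrite linear_sum /=; apply: eq_bigr => j _; rewrite tr_outer. Qed.

Lemma fam_max_attained (R : realType) (n : nat) (f : 'I_n -> R) : (0 < n)%N ->
  exists2 i, fam_max f = f i & forall j, f j <= fam_max f.
Proof.
move=> n0; pose i := [arg max_(k > Ordinal n0) f k]%O.
have iP j : f j <= f i by rewrite /i; case: arg_maxP => // k _; apply.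
suff fE : fam_max f = f i by exists i => // j; rewrite fE.
apply/le_anti/andP; split.
  by apply: ge_sup => [|_ [j _ <-]//]; exists (f i), i.
by apply: ub_le_sup; [exists (f i) => _ [j _ <-] | exists i].
Qed.

(** [g (S w)] is the finite sum over C of [g C] times the indicator of the fiber of [S] over C, and
    the law of [S] gives the integral of each indicator. *)
Lemma expectation_nice_sampling (disp : measure_display)
    (Omega : measurableType disp) (R : realType) (P : probability Omega R)
    (T : finType) (m : nat) (E : {set T}) (S : Omega -> {set T})
    (g : {set T} -> R) :
  nice_sampling P m E S ->
  'E_P[fun w => g (S w)]%E =
    (('C(#|E|, m)%:R)^-1 *
       \sum_(C : {set T} | (C \subset E) && (#|C| == m)) g C)%:E.
Proof.
move=> hS; rewrite unlock.
have mS C : measurable (S @^-1` [set C]) := (hS C).1.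
transitivity (\int[P]_w \sum_C ((g C)%:E * (\1_(S @^-1` [set C]) w)%:E))%E.
  apply: eq_integral => w _; rewrite (bigD1 (S w))//= big1 => [|C CS].
    by rewrite indicE mem_set// mule1 adde0.
  by rewrite indicE memNset ?mule0//= => /esym/eqP; apply/negP.
rewrite integral_sum//=; last first.
  by move=> C; apply: integrableZl => //; exact: integrable_indic.
rewrite mulr_sumr [in RHS]big_mkcond /= -sumEFin.
apply: eq_bigr => C _; rewrite integralZl//; last exact: integrable_indic.
rewrite integral_indic// setIT [X in (_ * X)%E](hS C).2 -EFinM.
by case: ifP => _; rewrite ?mulr0 1?mulrC.
Qed.

Lemma sub_setC1 (T : finType) (i : T) (C : {set T}) :
  (C \subset [set~ i]%SET) = (i \notin C).
Proof. by rewrite finset.subsetC finset.sub1set inE. Qed.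

(** Removing i and inserting i are mutually inverse bijections between the two index families. *)
Lemma sum_sets_containing (V : nmodType) (T : finType) (i : T) (b : nat)
    (f : {set T} -> V) : (0 < b)%N ->
  \sum_(B : {set T} | (#|B| == b) && (i \in B)) f B =
  \sum_(C : {set T} | (C \subset [set~ i]%SET) && (#|C| == b.-1)) f (i |: C)%SET.
Proof.
move=> b0.
rewrite (reindex_onto (fun C => i |: C)%SET (fun B => B :\ i)%SET) /=; last first.
  by move=> B /andP[_ iB]; rewrite finset.setD1K.
(* The reindexing demands that removing i from [i |: C] give back C, which fails exactly when i is
   in C. *)
apply: eq_bigl => C; rewrite setU11 andbT sub_setC1.
have [iC|iC] /= := boolP (i \in C).
  apply/negbTE; rewrite negb_and; apply/orP; right.
  by apply/eqP => /setP /(_ i); rewrite !inE eqxx iC.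
by rewrite cardsU1 iC setU1K// eqxx andbT add1n; case: b b0.
Qed.

(** This is used with o the outer product of a_i, x the sum over C and y the sum over all indices
    other than i: the terms [c *: x - p *: y] then form N_i(C). *)
Lemma scale_split (R : pzRingType) (V : lmodType R) (c p q : R) (o x y : V) :
  c = p + q ->
  c *: (o + x) = c *: x - p *: y + (p *: (o + y) + q *: o).
Proof.
move=> ->; rewrite [p *: (o + y)]scalerDr scalerDr addrC -!addrA; congr (_ + _).
by rewrite addrCA addrA addrA subrK scalerDl.
Qed.

(** * The bound for one value of the sample *)

Section Insert.
Variables (R : realType) (n d : nat) (a : 'I_n -> 'cV[R]_d) (U : R) (b : nat).
Hypotheses (hn : (2 <= n)%N) (hd : (1 <= d)%N) (hU : 0 <= U) (hb : (1 <= b <= n)%N).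

Lemma tr_deviation_mx i C : (deviation_mx a b i C)^T = deviation_mx a b i C.
Proof. by rewrite /deviation_mx linearB !linearZ /= !tr_sum_outer. Qed.

Lemma smooth_insert_le (i : 'I_n) (C : {set 'I_n}) :
  C \subset [set~ i]%SET -> #|C| == b.-1 ->
  smooth a U (i |: C)%SET <=
    practical_smoothness a U b + U * lambda_max (deviation_mx a b i C).
Proof.
rewrite sub_setC1 => iC Cb.
have /andP[b1 bn] := hb.
have cardiC : #|(i |: C)%SET| = b by rewrite cardsU1 iC (eqP Cb) add1n prednK.
have b0 : 0 < b%:R :> R by rewrite ltr0n.
have n1 : 0 < n%:R - 1 :> R by rewrite subr_gt0 ltr1n.
have n0 : 0 < n%:R :> R by rewrite ltr0n; exact: leq_trans hn.
(* These are the weights of the full sum and of a_i a_i^T. They add up to 1/b, and 1 <= b <= n makes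
   both nonnegative, so they can be pulled out of [lambda_max]. *)
pose p : R := b%:R^-1 * ((b%:R - 1) / (n%:R - 1)).
pose q : R := b%:R^-1 * ((n%:R - b%:R) / (n%:R - 1)).
have p0 : 0 <= p.
  by rewrite mulr_ge0 ?invr_ge0 ?divr_ge0 ?(ltW b0) ?(ltW n1)// subr_ge0 ler1n.
have q0 : 0 <= q.
  by rewrite mulr_ge0 ?invr_ge0 ?divr_ge0 ?(ltW b0) ?(ltW n1)// subr_ge0 ler_nat.
pose A := \sum_(j in [set: 'I_n]%SET) outer (a j).
have decomp : b%:R^-1 *: \sum_(j in (i |: C)%SET) outer (a j) =
    deviation_mx a b i C + (p *: A + q *: outer (a i)).
  have -> : A = outer (a i) + \sum_(j in [set~ i]%SET) outer (a j).
    rewrite /A (bigD1 i) ?finset.in_setT//=; congr (_ + _).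
    by apply: eq_bigl => j; rewrite !inE.
  rewrite big_setU1//=; apply: scale_split; rewrite /p /q; field.
  by rewrite !gt_eqF.
have trD := @tr_deviation_mx i C.
have trA : A^T = A by exact: tr_sum_outer.
have tra := tr_outer (a i).
set N := deviation_mx a b i C in decomp trD *.
set Z := \sum_(j in (i |: C)%SET) outer (a j) in decomp *.
have key : b%:R^-1 * lambda_max Z <=
    lambda_max N + (p * lambda_max A + q * lambda_max (outer (a i))).
  apply: (@le_trans _ _ (lambda_max (b%:R^-1 *: Z))).
    (* The converse half of homogeneity comes from scaling [b%:R^-1 *: Z] back by b. *)
    rewrite ler_pdivrMl//; apply: le_trans (lambda_maxZ_le hd _ (ltW b0)).
      by rewrite scalerA divff ?gt_eqF// scale1r.
    by rewrite linearZ /= tr_sum_outer.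
  rewrite decomp; apply: le_trans (lambda_maxD_le hd _ _) _ => //.
    by rewrite linearD !linearZ /= trA tra.
  rewrite lerD2l; apply: le_trans (lambda_maxD_le hd _ _) _ => //.
  - by rewrite linearZ /= trA.
  - by rewrite linearZ /= tra.
  - by rewrite lerD// lambda_maxZ_le.
have n_gt0 : (0 < n)%N by exact: leq_trans hn.
have [_ _ /(_ i)] := fam_max_attained (fun i => smooth a U [set i]%SET) n_gt0.
rewrite -/(smooth_max a U) {1}/smooth cards1 big_set1 divr1 => maxi.
rewrite /practical_smoothness /smooth_full /smooth cardiC cardsT card_ord -/A.
rewrite -/Z -/q -mulrA; apply: le_trans (ler_wpM2l hU key) _.
rewrite !mulrDr addrC lerD2r lerD//.
  (* The full-batch terms agree exactly, the factor n cancelling the 1/n in [smooth_full]. The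
     remaining goal, with weight [q], follows from L_i <= L_max. *)
  rewrite le_eqVlt; apply/orP; left; apply/eqP; rewrite /p; field.
  by rewrite !gt_eqF.
by rewrite mulrCA ler_wpM2l.
Qed.

End Insert.

(** * Averaging over the sample *)

Local Open Scope ereal_scope.

Theorem lemma3 (R : realType) (n d : nat) (hn : (2 <= n)%N) (hd : (1 <= d)%N)
    (a : 'I_n -> 'cV[R]_d) (U : R) (hU : (0 <= U)%R)
    (b : nat) (hb : (1 <= b <= n)%N)
    (disp : measure_display) (Omega : measurableType disp)
    (P : probability Omega R) (S : 'I_n -> Omega -> {set 'I_n})
    (hS : forall i : 'I_n, nice_sampling P b.-1 [set~ i]%SET (S i)) :
  (expected_smoothness a U b)%:E <=
    (practical_smoothness a U b)%:E
    + U%:E * \big[maxe/-oo]_(i < n)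
        'E_P[fun w : Omega => lambda_max (deviation_mx a b i (S i w))].
Proof.
have /andP[b1 bn] := hb.
rewrite /expected_smoothness; pose f (i : 'I_n) :=
  (\sum_(B : {set 'I_n} | (#|B| == b) && (i \in B)) smooth a U B)%R.
have [i -> _] := fam_max_attained f (leq_trans (isT : (0 < 2)%N) hn).
(* For the index i attaining the maximum in the expected smoothness constant, the expectation is at
   most the maximum over all indices, and U >= 0 preserves this. *)
apply: (@le_trans _ _ ((practical_smoothness a U b)%:E +
  U%:E * 'E_P[fun w => lambda_max (deviation_mx a b i (S i w))])); last first.
  by apply: leeD2l; apply: lee_wpmul2l; rewrite ?lee_fin//; exact: le_bigmax.
rewrite (expectation_nice_sampling (deviation_mx a b i \; @lambda_max R d) (hS i)).
rewrite -EFinM -EFinD lee_fin /f sum_sets_containing// cardsC1 card_ord.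
set Q := fun C : {set 'I_n} => (C \subset [set~ i]%SET) && (#|C| == b.-1).
(* The binomial coefficient counts the admissible C, so averaging leaves the constant
   [practical_smoothness a U b] unchanged. *)
have cQ : #|Q| = 'C(n.-1, b.-1).
  rewrite -[in RHS](card_ord n) -(cardsC1 i) -cards_draws -cardsE.
  by apply: eq_card => C; rewrite !inE.
have c0 : (0 < 'C(n.-1, b.-1)%:R :> R)%R.
  by rewrite ltr0n bin_gt0 -!subn1 leq_sub2r.
rewrite ler_pdivrMl// mulrDr [(U * _)%R]mulrCA mulVKf ?gt_eqF//.
apply: (@le_trans _ _ (\sum_(C | Q C) (practical_smoothness a U b +
    U * lambda_max (deviation_mx a b i C))))%R.
  by apply: ler_sum => C /andP[? ?]; exact: smooth_insert_le.
by rewrite big_split /= sumr_const cQ mulr_natl mulr_sumr.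
Qed.
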